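(* Let $R$ be a finite proper (left) nearfield and fix an ordering of $R\setminus\{0,1\}$. For every positive integer $m$, let $V_m$ be the matrix with $m$ columns over $R$ constructed as described in the context, and let $S_m\subset R^m$ be the set of its row vectors. Then $S_m$ is $R$-linearly independent and $gen(S_m)=R^m$ (i.e. $S_m$ is a seed set of $R^m$).
   Context: A (left) nearfield is a triple $(R,+,\cdot)$ such that $(R,+)$ is a group (necessarily abelian), $(R\setminus\{0\},\cdot)$ is a group, multiplication is associative, and $a(b+c)=ab+ac$ for all $a,b,c\in R$; one also has $0r=r0=0$. It is proper if it is not a division ring, i.e. there are $\alpha,\beta,\gamma\in R$ with $(\alpha+\beta)\gamma\neq\alpha\gamma+\beta\gamma$. $R^m$ carries componentwise addition and right scalar multiplication $(y_1,\dots,y_m)r=(y_1r,\dots,y_mr)$. An $R$-subgroup of $R^m$ is an additive subgroup closed under right multiplication by elements of $R$. For $S\subseteq R^m$, $gen(S)$ is the intersection of all $R$-subgroups containing $S$; $S$ is a seed set of an $R$-subgroup $T$ if $gen(S)=T$. A finite set $\{v_1,\dots,v_k\}$ is $R$-linearly independent if no $v_i$ lies in $gen(\{v_j: j\neq i\})$. Construction of $V_m$. Let $S=R\setminus\{0,1\}$ with a fixed ordering. For $k\ge 1$ define matrices $W_k=[\,I_k\mid T_k\,]$ with $k$ rows, where $I_k$ is the identity matrix, $T_1$ is empty, and for $k\ge 2$ $$T_k=\left[\begin{array}{c|c} T_{k-1} & \\ 0\cdots 0 & B_k\end{array}\right],$$ i.e. $T_k$ consists of $T_{k-1}$ with a zero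 row appended at the bottom, followed by the $k$-row block $B_k$ whose columns are, for $c=1,2,\dots,k-1$ in turn and, for each $c$, for $s$ running through $S$ in order, the column $(1,\dots,1,s,\dots,s)^{\mathsf T}$ with $c$ entries equal to $1$ followed by $k-c$ entries equal to $s$. Let $k$ be the smallest integer such that $W_k$ has at least $m$ columns; $V_m$ is the matrix formed by the first $m$ columns of $W_k$. (Thus $V_1=(1)$; a new row is added only when all columns available with the current number of rows have been used.) *)

(* Defs.v *)
From HB Require Import structures.
From mathcomp Require Import all_boot all_order all_fingroup all_algebra all_solvable.
Set Implicit Arguments.
Unset Strict Implicit.
Unset Printing Implicit Defensive.
Import GRing.Theory.
Local Open Scope ring_scope.

Reserved Notation "x ** y" (at level 40, left associativity).

(* Only left distributivity is required, so the ssralg hierarchy does not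
   apply above zmodType; the multiplicative group notations cannot be used
   either, because they denote addition on a finZmodType.
   - The last two axioms, with associativity, the unit laws and the absorption
     laws, say exactly that the nonzero elements form a group: closure under
     products and the fact that inverses are nonzero follow.
   - a ** 0 = 0 follows from distributivity, but 0 ** a = 0 does not: it fails
     on Z/2 with the multiplication a ** b := b. *)
HB.mixin Record Zmodule_isNearfield R of GRing.Zmodule R := {
  nf1 : R;
  nf_mul : R -> R -> R;
  nf_mulA : associative nf_mul;
  nf_mul1r : left_id nf1 nf_mul;
  nf_mulr1 : right_id nf1 nf_mul;
  nf_mulDr : right_distributive nf_mul +%R;
  nf_mul0r : left_zero 0 nf_mul;
  nf1_neq0 : nf1 != 0;
  nf_invP : forall a, a != 0 ->
    exists2 b, nf_mul b a = nf1 & nf_mul a b = nf1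
}.

#[short(type="nearfieldType")]
HB.structure Definition Nearfield :=
  {R of GRing.Zmodule R & Zmodule_isNearfield R}.

#[short(type="finNearfieldType")]
HB.structure Definition FinNearfield := {R of Nearfield R & Finite R}.

(* The additive group of a finite nearfield is necessarily abelian, so basing
   nearfields on zmodType loses nothing: left multiplications by nonzero
   elements are automorphisms acting transitively on the nonzero elements,
   hence the additive group is a p-group equal to its center. Here G is the
   additive group, in the multiplicative notation of finGroupType, and mul the
   nearfield multiplication. *)
Lemma finite_nearfield_addC (G : finGroupType) (one : G) (mul : G -> G -> G) :
    associative mul -> left_id one mul -> right_id one mul ->
    right_distributive mul *%g -> left_zero 1%g mul ->
    (forall a, a != 1%g -> exists2 b, mul b a = one & mul a b = one) ->
  commutative (@mulg G).
Proof.
move=> mulA mul1 mulr1 mulDr mul0 mulV.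
have trans (a b : G) : a != 1%g -> b != 1%g ->
    exists c d, [/\ mul c a = b & forall x, mul c (mul d x) = x].
  move=> a0 b0; have [a' a'a _] := mulV a a0; exists (mul b a').
  have ca : mul (mul b a') a = b by rewrite -mulA a'a mulr1.
  have c0 : mul b a' != 1%g.
    by apply: contraNneq b0 => c0; rewrite -ca c0 mul0.
  have [d _ cd] := mulV _ c0; exists d; split=> // x.
  by rewrite mulA cd mul1.
have mulX1 c : mul c 1%g = 1%g.
  by apply: (@mulgI G (mul c 1%g)); rewrite mulg1 -mulDr mulg1.
have mulX (c x : G) n : mul c (x ^+ n)%g = (mul c x ^+ n)%g.
  elim: n => [|n IHn]; last by rewrite !expgS -IHn mulDr.
  exact: mulX1.
have [G1 | ntG] := eqVneq [set: G]%G 1%G.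
  have all1 (x : G) : x = 1%g.
    by apply/set1P; rewrite -[[set 1%g]]/(gval 1%G) -G1 inE.
  by move=> x y; rewrite [x]all1 [y]all1.
have oG : (1 < #|[set: G]|)%N by rewrite cardG_gt1 -(inj_eq val_inj) in ntG *.
have [x _ ox] := Cauchy (pdiv_prime oG) (pdiv_dvd #|[set: G]|).
set p := pdiv _ in ox; have p_pr : prime p := pdiv_prime oG.
have x1 : x != 1%g.
  by apply: contraTneq p_pr => x1; rewrite -ox [x]x1 order1.
have pG : (p.-group [set: G])%g.
  rewrite -pnat_exponent; apply: (@pnat_dvd _ p); last exact: pnat_id.
  apply/exponentP => y _; have [-> | y1] := eqVneq y 1%g; first exact: expg1n.
  have [c [d [<- _]]] := trans x y x1 y1.
  rewrite -mulX -ox expg_order.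
  exact: mulX1.
have /trivgPn[z zZ z1] : 'Z([set: G])%g != 1%g.
  by apply: contraNneq ntG => /(trivg_center_pgroup pG) G1; apply/eqP/val_inj.
have [_ cz] := setIP zZ.
move=> y w; have [-> | y1] := eqVneq y 1%g; first by rewrite mul1g mulg1.
have [c [d [<- cd]]] := trans z y z1 y1.
rewrite -[w]cd -!mulDr; congr (mul c).
by apply: (centP cz (mul d w)); rewrite inE.
Qed.

HB.factory Record isFinNearfield R of Finite R := {
  zero : R;
  opp : R -> R;
  add : R -> R -> R;
  one : R;
  mul : R -> R -> R;
  addA : associative add;
  add0r : left_id zero add;
  addNr : left_inverse zero opp add;
  mulA : associative mul;
  mul1r : left_id one mul;
  mulr1 : right_id one mul;
  mulDr : right_distributive mul add;
  mul0r : left_zero zero mul;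
  one_neq0 : one != zero;
  invP : forall a, a != zero -> exists2 b, mul b a = one & mul a b = one
}.

HB.builders Context R of isFinNearfield R.
Definition additive_group := R.
HB.instance Definition _ := Finite.on additive_group.
HB.instance Definition _ :=
  Finite_isGroup.Build additive_group addA add0r addNr.

Fact addC : commutative add.
Proof.
exact: (@finite_nearfield_addC additive_group one mul
          mulA mul1r mulr1 mulDr mul0r invP).
Qed.
HB.instance Definition _ := GRing.isZmodule.Build R addA addC add0r addNr.
HB.instance Definition _ :=
  Zmodule_isNearfield.Build R mulA mul1r mulr1 mulDr mul0r one_neq0 invP.
HB.end.

Notation "x ** y" := (nf_mul x y) : ring_scope.

Definition proper_nearfield (R : nearfieldType) : Prop :=
  exists a b c : R, (a + b) ** c != a ** c + b ** c.

Definition rscale (R : nearfieldType) (m : nat) (y : 'rV[R]_m) (r : R) :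
    'rV[R]_m :=
  \row_j (y 0 j ** r).

Definition Rsubgroup (R : finNearfieldType) (m : nat) (T : {set 'rV[R]_m}) :
    bool :=
  [&& 0 \in T,
      [forall u in T, forall v in T, u - v \in T]
    & [forall u in T, forall r : R, rscale u r \in T]].

Definition gen (R : finNearfieldType) (m : nat) (A : {set 'rV[R]_m}) :
    {set 'rV[R]_m} :=
  \bigcap_(T : {set 'rV[R]_m} | Rsubgroup T && (A \subset T)) T.

Definition seed_set (R : finNearfieldType) (m : nat) (A T : {set 'rV[R]_m}) :
    Prop :=
  gen A = T.

Definition Rlin_indep (R : finNearfieldType) (m : nat) (A : {set 'rV[R]_m}) :
    Prop :=
  forall v, v \in A -> v \notin gen (A :\ v).

(* s is an ordering of R minus {0, 1}. *)
Definition ordering_no01 (R : finNearfieldType) (s : seq R) : Prop :=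
  uniq s /\ (forall x : R, (x \in s) = (x != 0) && (x != nf1)).

(* Matrices with k rows are given below by the sequence of their columns, from
   left to right. *)

Definition I_cols (R : nearfieldType) (k : nat) : seq 'cV[R]_k :=
  [seq \col_(i < k) (if i == j then nf1 else 0) | j <- enum 'I_k].

Definition B_cols (R : nearfieldType) (s : seq R) (k : nat) : seq 'cV[R]_k :=
  [seq \col_(i < k) (if (i < c)%N then nf1 else x) | c <- iota 1 k.-1, x <- s].

Definition append0 (R : nearfieldType) (k : nat) (u : 'cV[R]_k) : 'cV[R]_k.+1 :=
  castmx (addn1 k, erefl 1%N) (col_mx u 0).

(* T_0 is a dummy value; T_1 is empty, since B_1 is. *)
Fixpoint T_cols (R : nearfieldType) (s : seq R) (k : nat) : seq 'cV[R]_k :=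
  if k is k'.+1 then map (@append0 R k') (T_cols s k') ++ B_cols s k'.+1
  else [::].

Definition W_cols (R : nearfieldType) (s : seq R) (k : nat) : seq 'cV[R]_k :=
  I_cols R k ++ T_cols s k.

Lemma W_cols_unbounded (R : nearfieldType) (s : seq R) (m : nat) :
  exists k, (m <= size (W_cols s k))%N.
Proof.
by exists m; rewrite size_cat size_map size_enum_ord leq_addr.
Qed.

(* For m > 0 this minimum is positive, because W_0 has no column. *)
Definition V_height (R : nearfieldType) (s : seq R) (m : nat) : nat :=
  ex_minn (W_cols_unbounded s m).

Definition V_mx (R : nearfieldType) (s : seq R) (m : nat) :
    'M[R]_(V_height s m, m) :=
  \matrix_(i, j) nth 0 (W_cols s (V_height s m)) j i 0.

Definition S_rows (R : finNearfieldType) (s : seq R) (m : nat) :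
    {set 'rV[R]_m} :=
  [set row i (V_mx s m) | i : 'I_(V_height s m)].

(* Main.v *)
(** Call two coordinates of an R-subgroup T of R^m dependent if one is a left
    multiple of the other on all of T. If every coordinate is nonzero somewhere
    on T and no two are dependent, then T = R^m. Indeed, T then contains, for
    all c <> a, a vector with entry 1 at c and 0 at a; and if x and y in T have
    entry 1 at c and vanish on K and L respectively, then, choosing a, b, r with
    (a + b) r <> a r + b r, the vector (x a + y b) r - x a r - y b r of T is
    nonzero at c and vanishes on the union of K and L. Hence T contains every
    unit vector.
    The columns of W_k are pairwise distinct and have first nonzero entry 1, so
    they are not left multiples of each other. As V_m contains the columns of
    the identity matrix, the i-th row is the only one that is nonzero at the
    i-th coordinate, which gives independence. *)
Require Import Defs.
From mathcomp Require Import all_boot all_order all_algebra.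
Local Open Scope ring_scope.

Set Implicit Arguments.
Unset Strict Implicit.
Unset Printing Implicit Defensive.
Import GRing.Theory.

Section Nearfield.
Variable R : nearfieldType.
Implicit Types a b c : R.

Lemma nf_mulr0 a : a ** 0 = 0.
Proof. by apply: (addrI (a ** 0)); rewrite -nf_mulDr !addr0. Qed.

Lemma nf_mul_eq0 a b : (a ** b == 0) = (a == 0) || (b == 0).
Proof.
have [-> | a0] := eqVneq a 0; first by rewrite nf_mul0r eqxx.
apply/eqP/eqP => [ab0 | ->]; last exact: nf_mulr0.
have [c ca _] := nf_invP a a0.
by rewrite -[b]nf_mul1r -ca -nf_mulA ab0 nf_mulr0.
Qed.

Lemma nf_rinv a : a != 0 -> exists b, a ** b = nf1.
Proof. by case/nf_invP=> b _ ab; exists b. Qed.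

End Nearfield.

(** * R-subgroups of R^m and isolation of coordinates *)

Section Rsubgroups.
Variables (R : finNearfieldType) (m : nat).
Implicit Types (A T : {set 'rV[R]_m}) (u v : 'rV[R]_m).

Lemma RsubgroupP T :
  reflect [/\ 0 \in T, {in T &, forall u v, u - v \in T}
            & {in T, forall u (r : R), rscale u r \in T}] (Rsubgroup T).
Proof.
apply: (iffP and3P) => -[T0 TB TZ]; split=> //.
- by move=> u v Tu Tv; apply: (forall_inP (forall_inP TB u Tu)).
- by move=> u Tu r; apply: (forallP (forall_inP TZ u Tu)).
- by apply/forall_inP=> u Tu; apply/forall_inP=> v Tv; apply: TB.
- by apply/forall_inP=> u Tu; apply/forallP=> r; apply: TZ.
Qed.

Lemma genP A v :
  reflect (forall T, Rsubgroup T -> A \subset T -> v \in T) (v \in gen A).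
Proof.
apply: (iffP bigcapP) => [genv T sT AT | genv T /andP[sT AT]]; last exact: genv.
by apply: genv; rewrite sT.
Qed.

(** Serves to confine the rows other than a given one; closure under scaling rests on
    [0 ** r = 0]. *)
Lemma Rsubgroup_coord0 (c : 'I_m) : Rsubgroup [set u : 'rV[R]_m | u 0 c == 0].
Proof.
apply/RsubgroupP; split=> [|u v|u]; rewrite !inE ?mxE //.
  by move=> /eqP u0 /eqP v0; rewrite u0 v0 subrr.
by move=> /eqP u0 r; rewrite inE mxE u0 nf_mul0r.
Qed.

Section IndependentCoordinates.
Variable T : {set 'rV[R]_m}.
Hypothesis sT : Rsubgroup T.

Let T0 : 0 \in T. Proof. by case/RsubgroupP: sT. Qed.
Let TB : {in T &, forall u v, u - v \in T}. Proof. by case/RsubgroupP: sT. Qed.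
Let TZ : {in T, forall u (r : R), rscale u r \in T}.
Proof. by case/RsubgroupP: sT. Qed.
Let TD : {in T &, forall u v, u + v \in T}.
Proof.
by move=> u v Tu Tv; rewrite -[v]opprK TB // -[- v]add0r TB.
Qed.

(** [K] is a list so that zeros accumulate by concatenation and induction. *)
Definition isolates (c : 'I_m) (K : seq 'I_m) : Prop :=
  exists2 d, d \in T & d 0 c = nf1 /\ {in K, forall j, d 0 j = 0}.

Lemma isolates_scale c K u :
    u \in T -> u 0 c != 0 -> {in K, forall j, u 0 j = 0} -> isolates c K.
Proof.
move=> Tu /nf_rinv[r ur] u0; exists (rscale u r); first exact: TZ.
by split=> [|j Kj]; rewrite mxE // u0 // nf_mul0r.
Qed.

Lemma isolates_cat c K L : proper_nearfield R ->
  isolates c K -> isolates c L -> isolates c (K ++ L).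
Proof.
move=> [a [b [r abr]]] [x Tx [xc xK]] [y Ty [yc yL]].
pose xa := rscale x a; pose yb := rscale y b.
have Txa : xa \in T by apply: TZ.
have Tyb : yb \in T by apply: TZ.
apply: (@isolates_scale _ _ (rscale (xa + yb) r - rscale xa r - rscale yb r)).
- by rewrite !TB ?TZ ?TD.
- by rewrite !mxE xc yc !nf_mul1r -addrA -opprD subr_eq0.
- move=> j; rewrite mem_cat !mxE => /orP[/xK | /yL] ->.
    by rewrite !nf_mul0r add0r subr0 subrr.
  by rewrite !nf_mul0r addr0 subr0 subrr.
Qed.

Hypothesis nzT : forall c, exists2 u, u \in T & u 0 c != 0.
Hypothesis indT : forall (a c : 'I_m) (l : R), a != c ->
  exists2 u, u \in T & u 0 c != l ** u 0 a.

Lemma isolates_one c a : a != c -> isolates c [:: a].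
Proof.
move=> ac; have [u Tu ua] := nzT a.
have [x Tx [xa _]] : isolates a [::] by apply: isolates_scale Tu ua _.
(* With this multiplier, [vc] says exactly that [v - rscale x (v 0 a)] is nonzero at [c]; it
   vanishes at [a] because [x] has entry 1 there. *)
have [v Tv vc] := indT (x 0 c) ac.
apply: (@isolates_scale _ _ (v - rscale x (v 0 a))); first by rewrite TB ?TZ.
  by rewrite !mxE subr_eq0.
by move=> j; rewrite inE => /eqP->; rewrite !mxE xa nf_mul1r subrr.
Qed.

Lemma isolates_notin c K : proper_nearfield R -> c \notin K -> isolates c K.
Proof.
move=> hR; elim: K => [_ | a K IH].
  by have [u Tu uc] := nzT c; apply: isolates_scale Tu uc _.
rewrite inE negb_or eq_sym => /andP[ac cK].
by apply: (@isolates_cat c [:: a]) => //; [apply: isolates_one | apply: IH].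
Qed.

Lemma independent_coords_full : proper_nearfield R -> T = setT.
Proof.
move=> hR; apply/setP=> z; rewrite inE.
have Tsum (F : 'I_m -> 'rV[R]_m) : (forall j, F j \in T) -> \sum_j F j \in T.
  by move=> TF; elim/big_ind: _ => // u v; apply: TD.
have Td c : exists2 d, d \in T & d = \row_j (if j == c then z 0 c else 0).
  (* The list of all coordinates but [c]: [d] is a unit vector. *)
  have [|d Td [dc d0]] := @isolates_notin c (rem c (enum 'I_m)) hR.
    by rewrite mem_rem_uniqF ?enum_uniq.
  exists (rscale d (z 0 c)); first exact: TZ.
  apply/rowP=> j; rewrite !mxE; case: eqP => [-> | /eqP jc].
    by rewrite dc nf_mul1r.
  by rewrite d0 ?nf_mul0r // mem_rem_uniq ?enum_uniq // inE jc mem_enum.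
have -> : z = \sum_c \row_j (if j == c then z 0 c else 0).
  apply/rowP=> j; rewrite summxE (bigD1 j) //= mxE eqxx big1 ?addr0 // => i ij.
  by rewrite mxE eq_sym (negPf ij).
by apply: Tsum => c; have [d ? <-] := Td c.
Qed.

End IndependentCoordinates.

(** Both conditions on [A] pass to every R-subgroup containing [A], so each of these is full, and so
    is their intersection. *)
Lemma gen_eqT A : proper_nearfield R ->
    (forall c, exists2 u, u \in A & u 0 c != 0) ->
    (forall (a c : 'I_m) (l : R), a != c ->
       exists2 u, u \in A & u 0 c != l ** u 0 a) ->
  gen A = [set: 'rV[R]_m].
Proof.
move=> hR nzA indA; apply/setP=> z; rewrite inE; apply/genP=> T sT /subsetP AT.
rewrite (independent_coords_full sT) ?inE // => [c | a c l ac].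
  by have [u /AT] := nzA c; exists u.
by have [u /AT] := indA a c l ac; exists u.
Qed.

End Rsubgroups.

(** * Columns of [W_k] and [V_m] *)

Section Columns.
Variables (R : nearfieldType) (s : seq R).
Hypothesis s_uniq : uniq s.
Hypothesis s01 : forall x, x \in s -> (x != 0) && (x != nf1).

Definition normalized (k : nat) (u : 'cV[R]_k) : Prop :=
  exists2 i, u i 0 = nf1 & forall j : 'I_k, (j < i)%N -> u j 0 = 0.

(** As [l] is nonzero, [u] and [v] vanish in the same rows; hence their leading ones share a row,
    and comparing entries there gives [l = nf1]. *)
Lemma normalized_proportional k (u v : 'cV[R]_k) (l : R) :
  normalized u -> normalized v -> (forall i, v i 0 = l ** u i 0) -> v = u.
Proof.
move=> [i ui u0] [j vj v0] vE.
have lu1 : l ** u j 0 != 0 by rewrite -vE vj nf1_neq0.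
have [l0 uj] : l != 0 /\ u j 0 != 0.
  by move: lu1; rewrite nf_mul_eq0 negb_or => /andP.
have ij : i = j.
  apply/eqP; rewrite -val_eqE eqn_leq; apply/andP; split; rewrite leqNgt.
    by apply: contra uj => /u0 ->.
  apply/negP => /v0/eqP; rewrite vE ui nf_mulr1.
  exact/negP.
have l1 : l = nf1 by rewrite -[l]nf_mulr1 -{1}ui -vE ij.
by apply/colP=> h; rewrite vE l1 nf_mul1r.
Qed.

Lemma append0E k (u : 'cV[R]_k) (i : 'I_k.+1) :
  append0 u i 0 = if insub (val i) is Some j then u j 0 else 0.
Proof.
rewrite /append0 castmxE /= cast_ord_id mxE; case: splitP => j /= ij.
  rewrite ij; case: insubP => [j' _ /val_inj -> // |].
  by rewrite ltn_ord.
rewrite mxE; case: insubP => //= j' /= + _.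
by rewrite ij ltnNge leq_addr.
Qed.

Lemma append0_widen k (u : 'cV[R]_k) (i : 'I_k) :
  append0 u (widen_ord (leqnSn k) i) 0 = u i 0.
Proof. by rewrite append0E /= valK. Qed.

Lemma append0_last k (u : 'cV[R]_k) : append0 u ord_max 0 = 0.
Proof. by rewrite append0E /= insubN // ltnn. Qed.

Lemma append0_inj k : injective (@append0 R k).
Proof.
by move=> u v uv; apply/colP=> i; rewrite -append0_widen uv append0_widen.
Qed.

Lemma B_colsP k (u : 'cV[R]_k) : u \in B_cols s k ->
  exists c x, [/\ (0 < c < k)%N, x \in s
                & u = \col_(i < k) (if (i < c)%N then nf1 else x)].
Proof.
case/allpairsP=> -[c x] /= [+ xs ->]; rewrite mem_iota => /andP[c0 ck].
exists c, x; split=> //.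
by case: k {u} ck c0 => [|k] /=; [case: c | move=> -> ->].
Qed.

(** The ones stop before the last row. The resulting nonzero last entry separates the new block from
    the columns extended by zero. *)
Lemma B_cols_last k (u : 'cV[R]_k.+1) : u \in B_cols s k.+1 ->
  u ord_max 0 \in s.
Proof.
by case/B_colsP=> c [x [/andP[_ ck] xs ->]]; rewrite mxE ltnNge -ltnS ck.
Qed.

Lemma T_cols_head k (u : 'cV[R]_k) : u \in T_cols s k ->
  exists2 i : 'I_k, i = 0%N :> nat & u i 0 = nf1.
Proof.
elim: k u => // k IH u; rewrite mem_cat => /orP[/mapP[v /IH[i i0 vi] ->] |].
  by exists (widen_ord (leqnSn k) i); rewrite ?append0_widen.
case/B_colsP=> c [x [/andP[c0 _] _ ->]].
by exists ord0; rewrite // mxE c0.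
Qed.

(** Such an entry distinguishes these columns from those of the identity, which contain only 0 and
    1. *)
Lemma T_cols_mem k (u : 'cV[R]_k) : u \in T_cols s k ->
  exists i, u i 0 \in s.
Proof.
elim: k u => // k IH u; rewrite mem_cat => /orP[/mapP[v /IH[i vi] ->] |].
  by exists (widen_ord (leqnSn k) i); rewrite append0_widen.
by move/B_cols_last; exists ord_max.
Qed.

Lemma B_cols_uniq k : uniq (B_cols s k).
Proof.
apply: allpairs_uniq => // [|[c x] [d y]]; first exact: iota_uniq.
move=> /allpairsP[[c' x'] /= [cI xs [-> ->]]].
move=> /allpairsP[[d' y'] /= [dI ys [-> ->]]] {c x d y}.
move: c' x' d' y' cI xs dI ys => c x d y.
rewrite !mem_iota.
case: k => [|k] /=; first by case: c => // c; rewrite ltnS.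
rewrite !add1n !ltnS => /andP[_ ck] xs /andP[_ dk] ys /colP E.
have Exy : x = y by have := E ord_max; rewrite !mxE /= !ltnNge ck dk.
rewrite -Exy in E *; have /andP[_ /eqP x1] := s01 xs.
(* If the numbers of ones differ, the row indexed by the smaller one holds [x] in one column and 1
   in the other, against [x1]. *)
case: (ltngtP c d) => [cd | dc | -> //].
  have := E (Ordinal (leq_trans cd (leqW dk))).
  by rewrite !mxE /= ltnn cd.
have := E (Ordinal (leq_trans dc (leqW ck))).
by rewrite !mxE /= ltnn dc => /esym.
Qed.

Lemma T_cols_uniq k : uniq (T_cols s k).
Proof.
elim: k => //= k IH; rewrite cat_uniq (map_inj_uniq (@append0_inj k)) IH.
rewrite B_cols_uniq andbT; apply/hasPn=> u /B_cols_last uB.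
apply/mapP=> -[v _ uv]; have /andP[+ _] := s01 uB.
by rewrite uv append0_last eqxx.
Qed.

Lemma W_cols_uniq k : uniq (W_cols s k).
Proof.
rewrite cat_uniq T_cols_uniq andbT map_inj_uniq ?enum_uniq /=.
  apply/hasPn=> u /T_cols_mem[i /s01]; apply: contraL => /mapP[j _ ->].
  by rewrite mxE; case: (i == j); rewrite eqxx ?andbF.
move=> i j /colP/(_ i); rewrite !mxE eqxx; case: eqP => // _ /eqP.
by rewrite (negPf nf1_neq0).
Qed.

Lemma W_cols_normalized k (u : 'cV[R]_k) : u \in W_cols s k -> normalized u.
Proof.
rewrite mem_cat => /orP[/mapP[j _ ->] | /T_cols_head[i i0 ui]]; last first.
  by exists i => // j; rewrite i0.
exists j => [|i ij]; rewrite mxE ?eqxx //.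
by case: eqP => // E; rewrite E ltnn in ij.
Qed.

Lemma V_height_size m : (m <= size (W_cols s (V_height s m)))%N.
Proof. by rewrite /V_height; case: ex_minnP. Qed.

(** The identity block of [W_m] alone supplies [m] columns. By this bound, [V_m] contains a whole
    identity block. *)
Lemma V_height_le m : (V_height s m <= m)%N.
Proof.
rewrite /V_height; case: ex_minnP => k _; apply.
by rewrite size_cat size_map size_enum_ord leq_addr.
Qed.

Lemma col_V_mx m (j : 'I_m) : col j (V_mx s m) = (W_cols s (V_height s m))`_j.
Proof. by apply/colP=> i; rewrite !mxE. Qed.

Lemma V_mx_normalized m (j : 'I_m) : normalized (col j (V_mx s m)).
Proof.
rewrite col_V_mx; apply: W_cols_normalized; apply: mem_nth.
exact: leq_trans (V_height_size m).
Qed.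

Lemma V_mx_col_inj m : injective (fun j => col j (V_mx s m)).
Proof.
move=> i j; rewrite !col_V_mx => /eqP.
rewrite nth_uniq ?W_cols_uniq ?(leq_trans _ (V_height_size m)) //.
by move/eqP/val_inj.
Qed.

Lemma V_mx_identity m (i j : 'I_(V_height s m)) :
  V_mx s m i (widen_ord (V_height_le m) j) = if i == j then nf1 else 0.
Proof.
rewrite mxE /W_cols nth_cat size_map size_enum_ord /= ltn_ord.
by rewrite (nth_map j) ?size_enum_ord // mxE nth_ord_enum.
Qed.

End Columns.

Theorem theorem4p3 (R : finNearfieldType) (s : seq R) (m : nat)
    (hproper : proper_nearfield R) (hs : ordering_no01 s) (hm : (0 < m)%N) :
  Rlin_indep (S_rows s m) /\ seed_set (S_rows s m) [set: 'rV[R]_m].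
Proof.
have [us sE] := hs.
have s01 x : x \in s -> (x != 0) && (x != nf1) by rewrite sE.
split=> [v /imsetP[i _ vE] | ].
  pose c := widen_ord (V_height_le s m) i.
  (* The other rows all vanish at [c], hence so would [v], whose entry there is 1. *)
  apply/negP=> /genP/(_ _ (Rsubgroup_coord0 R c)).
  rewrite inE {2}vE mxE V_mx_identity eqxx (negPf nf1_neq0) => vN.
  suff: false by []; apply: vN; apply/subsetP=> u /setD1P[uv /imsetP[j _ uE]].
  rewrite inE uE mxE V_mx_identity; case: (eqVneq j i) => // ji.
  by rewrite uE vE ji eqxx in uv.
apply: gen_eqT => // [c | a c l ac].
  have [i Vi _] := V_mx_normalized s c.
  exists (row i (V_mx s m)); first exact: imset_f.
  by move: Vi; rewrite !mxE => ->; apply: nf1_neq0.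
(* If no row witnesses the inequality, column [c] is [l] times column [a], so the two normalized
   columns coincide. *)
have [/existsP[i Vi] | /existsPn all_eq] :=
  boolP [exists i, V_mx s m i c != l ** V_mx s m i a].
  by exists (row i (V_mx s m)); [apply: imset_f | rewrite !mxE in Vi *].
have Eca : col c (V_mx s m) = col a (V_mx s m).
  apply: (@normalized_proportional _ _ _ _ l); try exact: V_mx_normalized.
  by move=> i; have /negPn/eqP := all_eq i; rewrite !mxE.
by rewrite (V_mx_col_inj us s01 Eca) eqxx in ac.
Qed.
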